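(* Let $\mathbb{K}$ be a Galois number field of degree $n$, let $G=\operatorname{Gal}(\mathbb{K}/\mathbb{Q})$ be its Galois group, let $M$ be a $\mathbb{Z}$-submodule of $\mathbb{K}$ of rank $n$, and let $G_M=\{\tau|_M:\tau\in G\}$. If $G_M$ is a group, then $G_M$ is isomorphic to $G$.
   Context: A Galois number field is a number field $\mathbb{K}$ such that $\mathbb{K}/\mathbb{Q}$ is Galois. $\tau|_M$ denotes the restriction of $\tau$ to $M$, a map $M\to\mathbb{K}$. Saying that $G_M$ is a group means that composition is a well-defined operation on $G_M$ (for all $\tau,\tau'\in G$ one has $\tau'(M)\subseteq M$, so that $\tau|_M\circ\tau'|_M$ makes sense, and this composite lies in $G_M$) which makes $G_M$ a group. *)

(* Defs.v *)
From mathcomp Require Import all_boot all_order all_fingroup all_algebra all_field.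
From mathcomp Require Import boolp classical_sets.

Set Implicit Arguments.
Unset Strict Implicit.
Unset Printing Implicit Defensive.

Import GRing.Theory.
Local Open Scope classical_set_scope.
Local Open Scope group_scope.
Local Open Scope ring_scope.

(* [zmodule V] is the abelian group [V] seen as a module over [int]. *)
Definition Zsubmodule (V : zmodType) (M : set V) : Prop :=
  GRing.submod_closed (fun x : zmodule V => (x : V) \in M).

Definition Zindependent (V : zmodType) (m : nat) (v : 'I_m -> V) : Prop :=
  forall c : 'I_m -> int, \sum_(i < m) v i *~ c i = 0 -> forall i, c i = 0.

(* The rank of a Z-module, which need not be finitely generated, is the largest
   size of a Z-linearly independent family. *)
Definition has_Zrank (V : zmodType) (M : set V) (n : nat) : Prop :=
  (exists2 v : 'I_n -> V, (forall i, M (v i)) & Zindependent v) /\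
  (forall (m : nat) (v : 'I_m -> V),
     (forall i, M (v i)) -> Zindependent v -> (m <= n)%N).

Definition group_law (T : Type) (op : T -> T -> T) : Prop :=
  associative op /\
  exists (e : T) (inv : T -> T),
    [/\ left_id e op, right_id e op, left_inverse e inv op
      & right_inverse e inv op].

Definition isomorphic_laws (S T : Type) (opS : S -> S -> S)
    (opT : T -> T -> T) : Prop :=
  exists2 phi : S -> T,
    bijective phi & forall x y, phi (opS x y) = opT (phi x) (phi y).

Definition GalQ (K : splittingFieldType rat) : Type :=
  [subg 'Gal({:K} / 1%AS)].

(* The product of ['Gal(_ / _)] is in diagrammatic order, [(s * t) a = t (s a)];
   this is the usual composition, [gal_comp s t] mapping [a] to [s (t a)]. *)
Definition gal_comp (K : splittingFieldType rat) (s t : GalQ K) : GalQ K :=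
  (t * s)%g.

(* A set [M] used as a type denotes the type of its elements. *)
Definition restr (K : splittingFieldType rat) (M : set K) (t : gal_of {:K}) :
    M -> K :=
  fun x => t (val x).

Arguments restr {K} M t _.

Definition restr_gal (K : splittingFieldType rat) (M : set K) : set (M -> K) :=
  [set f | exists2 t, t \in 'Gal({:K} / 1%AS) & f = restr M t].

Arguments restr_gal {K} M _.

(* [h] is the composite of [f] after [g]; in particular [g] maps [M] to [M]. *)
Definition is_comp (K : splittingFieldType rat) (M : set K) (f g h : M -> K) :
    Prop :=
  forall x : M, exists2 y : M, val y = g x & h x = f y.

(* Since [is_comp f g] determines [h], there is at most one such [op]; it exists
   iff every element of [restr_gal M] maps [M] to [M] and [restr_gal M] is
   closed under composition. *)
Definition composition_law (K : splittingFieldType rat) (M : set K)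
    (op : restr_gal M -> restr_gal M -> restr_gal M) : Prop :=
  forall f g, is_comp (val f) (val g) (val (op f g)).

(* Main.v *)
(* A Z-module of rank n = [K : Q] contains a Q-basis of K, because clearing
   denominators turns Z-independence into Q-independence. An automorphism is
   therefore determined by its restriction to M, and restriction to M is the
   required isomorphism. *)
Require Import Defs.
From mathcomp Require Import all_boot all_order all_fingroup all_algebra all_field.
From mathcomp Require Import boolp classical_sets.

Import GRing.Theory.

Lemma Zindependent_free (V : vectType rat) (m : nat) (v : 'I_m -> V) :
  Zindependent v -> free [tuple v i | i < m].
Proof.
move=> vZ; apply/freeP => k sumk0 i.
(* [c j] is [k j] times the product of the denominators of all coefficients: [denq (k j)] cancels to
   leave [numq (k j)], so the result is an integer. *)
pose c (j : 'I_m) : int := (numq (k j) * \prod_(l | l != j) denq (k l))%R.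
have cE j : ((c j)%:~R = (\prod_l (denq (k l))%:~R) * k j :> rat)%R.
  rewrite [in RHS](bigD1 j) //= mulrAC [(_ * k j)%R]mulrC -numqE /c rmorphM /=.
  by rewrite rmorph_prod.
have c0 : c i = 0%R.
  apply: (vZ c); rewrite -[RHS](scaler0 _ (\prod_l (denq (k l))%:~R)%R).
  rewrite -[in RHS]sumk0 scaler_sumr; apply: eq_bigr => j _.
  by rewrite -scaler_int cE scalerA -tnth_nth tnth_mktuple.
have /eqP := cE i; rewrite c0 mulr0z eq_sym mulf_eq0 prodf_seq_eq0.
case/orP => [/hasP[j _ /=]|/eqP//].
by rewrite intr_eq0 (negPf (denq_neq0 _)).
Qed.

Lemma gal_eq_on_basis {F : fieldType} {L : splittingFieldType F}
    {E : {subfield L}} {m : nat} {X : m.-tuple L} {s t : gal_of E} :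
  basis_of E X -> (forall i, s (tnth X i) = t (tnth X i)) -> s = t.
Proof.
move=> basX st; apply/eqP/gal_eqP => x Ex; rewrite (coord_basis basX Ex).
rewrite !linear_sum; apply: eq_bigr => i _.
by rewrite !linearZ /= -tnth_nth st.
Qed.

Lemma restr_inj {K : splittingFieldType rat} {M : set K} :
  has_Zrank M (\dim {:K}) -> injective (@restr K M).
Proof.
case=> -[v Mv vZ] _ s t st.
have basv : basis_of {:K} [tuple v i | i < \dim {:K}].
  (* A free family whose length is the dimension of [K] spans [K]. *)
  by rewrite basisEfree Zindependent_free // subvf size_tuple leqnn.
apply: (gal_eq_on_basis basv) => i; rewrite tnth_mktuple.
exact: (congr1 (@^~ (exist _ (v i) (mem_set (Mv i)))) st).
Qed.

Theorem corollary11 (K : splittingFieldType rat) (n : nat)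
    (galK : galois 1%AS {:K}) (dimK : \dim {:K} = n)
    (M : set K) (subM : Zsubmodule M) (rankM : has_Zrank M n)
    (op : restr_gal M -> restr_gal M -> restr_gal M)
    (opE : composition_law op) (opG : group_law op) :
  isomorphic_laws (@gal_comp K) op.
Proof.
rewrite -dimK in rankM.
have restrP (s : GalQ K) : restr M (sgval s) \in restr_gal M.
  by apply/mem_set; exists (sgval s) => //; exact: subgP.
pose phi s : restr_gal M := exist _ (restr M (sgval s)) (restrP s).
have phi_inj : injective phi.
  by move=> s t /(congr1 val)/(restr_inj rankM)/val_inj.
have phi_surj f : exists s, phi s = f.
  case: f => f Mf; have [t Gt ft] := set_mem Mf.
  by exists (subg _ t); apply: val_inj; rewrite /= ft subgK.
(* Choosing preimages gives a right inverse of [phi]; injectivity of [phi] makes it a left inverse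
   as well. *)
have [psi psiK] := choice phi_surj.
exists phi => [|s t].
  by exists psi => // s; apply: phi_inj; rewrite psiK.
apply: val_inj; apply/funext => x.
(* Here [y] is the image of [x] under [t], seen as an element of [M]. Both sides equal [s (t x)]:
   [galM] reads the product [t * s] in [gal_comp s t] as [t] followed by [s]. *)
have [y yE ->] := opE (phi s) (phi t) x.
by rewrite /= /restr yE /= galM ?memvf.
Qed.
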